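(* Let $d\ge2$ be an integer, $q>-d$ real, $0\le m\le n$ integers, and $1\le l\le\dim\mathcal H_m^d$. Then, for every $x\in\mathbb R^d$ and $t>0$, $$\lim_{p\to\infty}S_{n,m,l}^{p,q,M}\!\left(x,\frac tp\right)=(-1)^{n-m}(n-m)!\,L_{n-m}^{q+2m+d-1}(t)\,Y_l^m(x)=(-1)^{n-m}(n-m)!\,S_{n,m,l}^{q,L}(x,t).$$
   Context: Univariate polynomials: $M_n^{(p,q)}(x)=(-1)^n\frac{(1+x)^{p+q}}{x^q}\frac{d^n}{dx^n}\left(x^{n+q}(1+x)^{n-p-q}\right)$, a polynomial of degree at most $n$ in $x$. Laguerre polynomials: $L_n^{a}(x)=\frac{x^{-a}e^x}{n!}\frac{d^n}{dx^n}\left(x^{n+a}e^{-x}\right)$, $a>-1$. $\mathcal H_m^d$ is the space of harmonic homogeneous polynomials of degree $m$ in $d$ variables, and $\{Y_l^m:1\le l\le\dim\mathcal H_m^d\}$ is a fixed orthonormal basis of it in $L^2$ of the unit sphere $\mathbb S^{d-1}$ with normalized surface measure. As polynomials in $(x,t)\in\mathbb R^d\times\mathbb R$ (with $x$ and $t$ treated as independent variables), $$S_{n,m,l}^{p,q,M}(x,t)=M_{n-m}^{(p-2m-d+1,\;q+2m+d-1)}(t)\,Y_l^m(x),\qquad S_{n,m,l}^{\beta,L}(x,t)=L_{n-m}^{2m+\beta+d-1}(t)\,Y_l^m(x).$$ *)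

(* Defs.v *)
From HB Require Import structures.
From mathcomp Require Import all_boot all_order all_algebra.
From mathcomp Require mpoly.

Set Implicit Arguments.
Unset Strict Implicit.
Unset Printing Implicit Defensive.

Import GRing.Theory.
Local Open Scope ring_scope.

(* mpoly is imported only inside this module because its notations clash with
   those of mathcomp-analysis. *)
Module HarmonicPoly.
Import mpoly.

Definition peval (R : comNzRingType) (d : nat) (p : {mpoly R[d]}) (x : 'rV[R]_d) : R :=
  p.@[fun i => x 0 i].

Definition laplacian (R : nzRingType) (d : nat) (p : {mpoly R[d]}) : {mpoly R[d]} :=
  \sum_(i < d) p^`M(i)^`M(i).

Definition harmonic (R : nzRingType) (d m : nat) : {pred {mpoly R[d]}} :=
  [pred p | (p \is m.-homog) && (laplacian p == 0)].

Definition harmonic_basis (R : nzRingType) (d m N : nat)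
    (Y : 'I_N -> {mpoly R[d]}) : Prop :=
  (forall i, Y i \in harmonic m) /\
  (forall h, h \in harmonic m ->
     exists! c : 'rV[R]_N, h = \sum_(i < N) c 0 i *: Y i).

End HarmonicPoly.
Import HarmonicPoly.

From mathcomp Require Import all_classical all_reals all_analysis.
From mathcomp Require Import ring lra.
Import numFieldNormedType.Exports Order.TTheory Num.Theory.
Local Open Scope classical_set_scope.
Local Open Scope ring_scope.

(* [sphere_int d f] is the surface integral of f over the unit sphere of R^d in
   spherical coordinates.  For d = 1 the sphere is {1, -1} with counting measure.
   For d >= 2 a point is (cos t, sin t *: xi) with t in [0, pi] and xi in the unit
   sphere of R^(d-1), and the surface element is (sin t)^(d-2) dt dsigma(xi). *)
Fixpoint sphere_int (R : realType) (d : nat) : ('rV[R]_d -> R) -> R :=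
  match d return ('rV[R]_d -> R) -> R with
  | 0 => fun=> 0
  | k.+1 => fun f : 'rV[R]_(1 + k) -> R =>
      if k == 0%N then f (const_mx 1) + f (const_mx (-1))
      else \int[lebesgue_measure]_(t in `[0, pi])
             (sin t ^+ k.-1 *
              sphere_int (fun xi : 'rV[R]_k => f (row_mx (cos t)%:M (sin t *: xi))))
  end.

Definition sphere_mean (R : realType) (d : nat) (f : 'rV[R]_d -> R) : R :=
  sphere_int f / sphere_int (fun _ : 'rV[R]_d => 1).

Definition sphere_orthonormal (R : realType) (d N : nat)
    (Y : 'I_N -> mpoly.mpoly d R) : Prop :=
  forall i j, sphere_mean (fun x => peval (Y i) x * peval (Y j) x) = (i == j)%:R.

Definition spherical_harmonics (R : realType) (d m N : nat)
    (Y : 'I_N -> mpoly.mpoly d R) : Prop :=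
  harmonic_basis m Y /\ sphere_orthonormal Y.

(* the polynomial that coincides with f on ]0, +oo[ ([poly_on_eq]); used when f is
   given by a Rodrigues formula, whose real powers make sense there only *)
Definition poly_on (R : realType) (f : R -> R) : {poly R} :=
  xget 0 [set P : {poly R} | forall x, 0 < x -> P.[x] = f x].

Definition M_rodrigues (R : realType) (n : nat) (p q x : R) : R :=
  (-1) ^+ n * ((1 + x) `^ (p + q) / x `^ q) *
  derive1n n (fun y : R => y `^ (n%:R + q) * (1 + y) `^ (n%:R - p - q)) x.

Definition M_poly (R : realType) (n : nat) (p q : R) : {poly R} :=
  poly_on (M_rodrigues n p q).

Definition laguerre_rodrigues (R : realType) (n : nat) (a x : R) : R :=
  x `^ (- a) * expR x / n`!%:R *
  derive1n n (fun y : R => y `^ (n%:R + a) * expR (- y)) x.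

Definition laguerre (R : realType) (n : nat) (a : R) : {poly R} :=
  poly_on (laguerre_rodrigues n a).

Section RodriguesPolynomials.
Variable R : realType.
Implicit Types (x : R) (f g : R -> R) (P : {poly R}).

Lemma poly_on_eq f P : (forall x, 0 < x -> P.[x] = f x) -> poly_on f = P.
Proof.
move=> Pf; apply: xget_unique => // Q Qf; apply/eqP; rewrite -subr_eq0; apply/eqP.
pose s := mkseq (fun i => i.+1%:R : R) (size (Q - P)).
apply: (@roots_geq_poly_eq0 _ _ s); last by rewrite size_mkseq.
  apply/allP => _ /mapP[i _ ->].
  by rewrite /root hornerD hornerN Qf ?Pf ?ltr0n// subrr.
by apply/mkseq_uniq => i j /eqP; rewrite eqr_nat eqSS => /eqP.
Qed.

Lemma derive1_pos f g x (df : R) : 0 < x -> (forall y, 0 < y -> f y = g y) ->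
  is_derive x 1 g df -> derive1 f x = df.
Proof.
move=> x0 fg gx; rewrite derive1E.
rewrite (@near_eq_derive _ _ _ f g) ; first exact: derive_val.
by near=> y; apply: fg; near: y; exact: lt_nbhsr.
Unshelve. all: by end_near. Qed.

Lemma M_rodrigues_poly n (p q : R) :
  exists P, forall x, 0 < x -> P.[x] = M_rodrigues n p q x.
Proof.
pose a : R := n%:R + q; pose b : R := n%:R - p - q.
pose F := fun y : R => y `^ a * (1 + y) `^ b.
have H k : exists P, forall x, 0 < x ->
    derive1n k F x = x `^ (a - k%:R) * (1 + x) `^ (b - k%:R) * P.[x].
  elim: k => [|k [P IH]].
    by exists 1 => x x0; rewrite derive1n0 !subr0 hornerC mulr1.
  exists (((a - k%:R)%:P * (1 + 'X) + (b - k%:R)%:P * 'X) * P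
          + 'X * (1 + 'X) * P^`()) => x x0; rewrite derive1nS.
  have y0 : 0 < 1 + x by rewrite addr_gt0.
  have d1 := is_derive1_powR (a - k%:R) x0.
  have dx : is_derive x 1 (fun y : R => 1 + y) 1.
    by have := is_deriveD (is_derive_cst (1 : R) x 1) (is_derive_id x 1); rewrite add0r.
  have d2 := is_derive1_comp (is_derive1_powR (b - k%:R) y0) dx.
  have d3 := is_deriveM (is_deriveM d1 d2) (is_derive_poly P x).
  rewrite (derive1_pos x0 IH d3) /= !(fctE, hornerE) /GRing.scale /=.
  have E (c y : R) : 0 < y -> y `^ (c - k%:R) = y * y `^ (c - k.+1%:R).
    move=> yp; rewrite -[X in _ = X * _]powRr1 ?ltW// -powRD; last by apply/implyP => _; rewrite gt_eqF.
    by congr (_ `^ _); rewrite -natr1; ring.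
  have E' (c y : R) : y `^ (c - k%:R - 1) = y `^ (c - k.+1%:R).
    by congr (_ `^ _); rewrite -natr1; ring.
  by rewrite !E' (E a x)// (E b (1 + x))//; ring.
have [P HP] := H n; exists ((-1) ^+ n *: P) => x x0.
have y0 : 0 < 1 + x by rewrite addr_gt0.
rewrite hornerZ /M_rodrigues -/F HP //.
have -> : a - n%:R = q by rewrite /a; ring.
have -> : b - n%:R = - (p + q) by rewrite /b; ring.
rewrite powRN; field.
by rewrite !gt_eqF ?powR_gt0.
Qed.

Lemma M_polyE n (p q : R) x : 0 < x -> (M_poly n p q).[x] = M_rodrigues n p q x.
Proof.
by have [P HP] := M_rodrigues_poly n p q; rewrite /M_poly (poly_on_eq HP); exact: HP.
Qed.

Lemma laguerre_rodrigues_poly n (a : R) :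
  exists P, forall x, 0 < x -> P.[x] = laguerre_rodrigues n a x.
Proof.
pose c : R := n%:R + a; pose F := fun y : R => y `^ c * expR (- y).
have H k : exists P, forall x, 0 < x ->
    derive1n k F x = x `^ (c - k%:R) * expR (- x) * P.[x].
  elim: k => [|k [P IH]].
    by exists 1 => x x0; rewrite derive1n0 !subr0 hornerC mulr1.
  exists (((c - k%:R)%:P - 'X) * P + 'X * P^`()) => x x0; rewrite derive1nS.
  have d1 := is_derive1_powR (c - k%:R) x0.
  have dx : is_derive x 1 (fun y : R => - y) (-1) by exact: is_deriveN (is_derive_id x 1).
  have d2 := is_derive1_comp (is_derive_expR (- x)) dx.
  have d3 := is_deriveM (is_deriveM d1 d2) (is_derive_poly P x).
  rewrite (derive1_pos x0 IH d3) /= !(fctE, hornerE) /GRing.scale /=.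
  have -> : x `^ (c - k%:R) = x * x `^ (c - k%:R - 1).
    rewrite -[X in _ = X * _]powRr1 ?ltW// -powRD; last by apply/implyP => _; rewrite gt_eqF.
    by congr (_ `^ _); ring.
  have -> : c - k.+1%:R = c - k%:R - 1 by rewrite -natr1; ring.
  by ring.
have [P HP] := H n; exists (n`!%:R^-1 *: P) => x x0.
rewrite hornerZ /laguerre_rodrigues -/F HP //.
have -> : c - n%:R = a by rewrite /c; ring.
rewrite powRN expRN; field.
by rewrite pnatr_eq0 -lt0n fact_gt0 !gt_eqF ?powR_gt0 ?expR_gt0.
Qed.

Lemma laguerreE n (a : R) x : 0 < x -> (laguerre n a).[x] = laguerre_rodrigues n a x.
Proof.
have [P HP] := laguerre_rodrigues_poly n a.
by rewrite /laguerre (poly_on_eq HP); exact: HP.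
Qed.

End RodriguesPolynomials.

Definition S_M (R : realType) (d n m : nat) (p q : R) (Ylm : mpoly.mpoly d R)
    (x : 'rV[R]_d) (t : R) : R :=
  (M_poly (n - m) (p - 2 * m%:R - d%:R + 1) (q + 2 * m%:R + d%:R - 1)).[t]
  * peval Ylm x.

Definition S_L (R : realType) (d n m : nat) (beta : R) (Ylm : mpoly.mpoly d R)
    (x : 'rV[R]_d) (t : R) : R :=
  (laguerre (n - m) (2 * m%:R + beta + d%:R - 1)).[t] * peval Ylm x.

(* Main.v *)
(** With [e = 1 / p], the [k]-th derivative of [y `^ a * (1 + y) `^ (b - p)] at
   [y = e x] is [y `^ (a - k) * (1 + y) `^ (b - p - k)] times a polynomial in
   [(x, e)].  At [e = 0] the recursion on [k] satisfied by these polynomials is the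
   one attached to [y `^ a * expR (- y)], so the limit [p --> +oo] is the continuity
   of a polynomial at [0]. *)
Require Import Defs.
From HB Require Import structures.
From mathcomp Require Import all_boot all_order all_algebra.
From mathcomp Require mpoly.
From mathcomp Require Import all_classical all_reals all_analysis.
From mathcomp Require Import ring.
Import numFieldNormedType.Exports Order.TTheory GRing.Theory Num.Theory.
Import HarmonicPoly.
Local Open Scope classical_set_scope.
Local Open Scope ring_scope.

Section JacobiToLaguerre.
Variable R : realType.
Implicit Types (a b e p q r t x y : R) (k n : nat).

(* The outer variable stands for [x], the inner one for [e = 1 / p]. *)
Fixpoint rodrigues_poly a b k : {poly {poly R}} :=
  if k is k'.+1 then
    ((a - k'%:R)%:P%:P * (1 + 'X%:P * 'X) + ((b - k'%:R) *: 'X - 1)%:P * 'X)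
      * rodrigues_poly a b k'
    + 'X * (1 + 'X%:P * 'X) * (rodrigues_poly a b k')^`()
  else 1.

Definition rodrigues_at a b e k : {poly R} :=
  map_poly (horner_eval e) (rodrigues_poly a b k).

Lemma rodrigues_atE a b e k x :
  (rodrigues_at a b e k).[x] = (rodrigues_poly a b k).[x%:P].[e].
Proof.
have {1}-> : x = horner_eval e x%:P by rewrite /horner_eval hornerC.
by rewrite horner_map.
Qed.

(** Evaluating the inner variable at [e] commutes with differentiation in the outer one, so the
    recursion survives specialization. *)
Lemma rodrigues_atS a b e k x :
  (rodrigues_at a b e k.+1).[x] =
    ((a - k%:R) * (1 + e * x) + ((b - k%:R) * e - 1) * x)
      * (rodrigues_at a b e k).[x]
    + x * (1 + e * x) * (rodrigues_at a b e k)^`().[x].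
Proof.
rewrite rodrigues_atE /= deriv_map.
have -> : (map_poly (horner_eval e) (rodrigues_poly a b k)^`()).[x] =
    (rodrigues_poly a b k)^`().[x%:P].[e].
  have {1}-> : x = horner_eval e x%:P by rewrite /horner_eval hornerC.
  by rewrite horner_map.
by rewrite rodrigues_atE !hornerE.
Qed.

Lemma powRS y c k : 0 < y -> y `^ (c - k%:R) = y * y `^ (c - k.+1%:R).
Proof.
move=> y0; rewrite -[X in _ = X * _]powRr1 ?ltW// -powRD.
  by congr (_ `^ _); rewrite -natr1; ring.
by apply/implyP => _; rewrite gt_eqF.
Qed.

(** Put [x = p * y] and [e = p^-1]. In the product rule [(b - p - k) * y] becomes
    [((b - k) * e - 1) * x], and the chain-rule factor [p] turns [y * (1 + y)] into
    [x * (1 + e * x)]: this is the recursion of [rodrigues_poly]. *)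
Lemma derive1n_jacobi_weight a b p k y : 0 < p -> 0 < y ->
  derive1n k (fun z : R => z `^ a * (1 + z) `^ (b - p)) y =
    y `^ (a - k%:R) * (1 + y) `^ (b - p - k%:R)
      * (rodrigues_at a b p^-1 k).[p * y].
Proof.
move=> p0; elim: k y => [|k IH] y y0.
  by rewrite derive1n0 !subr0 rodrigues_atE /= !hornerE.
rewrite derive1nS.
have y1 : 0 < 1 + y by rewrite addr_gt0.
have d1 := is_derive1_powR (a - k%:R) y0.
have dx : is_derive y 1 (fun z : R => 1 + z) 1.
  by have := is_deriveD (is_derive_cst (1 : R) y 1) (is_derive_id y 1); rewrite add0r.
have d2 := is_derive1_comp (is_derive1_powR (b - p - k%:R) y1) dx.
pose P := rodrigues_at a b p^-1 k.
(* Composing with [p *: 'X] makes the last factor a polynomial in the variable of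
   differentiation. *)
have d3 := is_deriveM (is_deriveM d1 d2) (is_derive_poly (P \Po (p *: 'X)) y).
have IH' z : 0 < z ->
    derive1n k (fun z : R => z `^ a * (1 + z) `^ (b - p)) z =
    z `^ (a - k%:R) * (1 + z) `^ (b - p - k%:R) * (P \Po (p *: 'X)).[z].
  by move=> z0; rewrite IH// horner_comp !hornerE.
rewrite (derive1_pos y0 IH' d3) /= deriv_comp derivZ derivX.
rewrite !(fctE, hornerE, horner_comp) /GRing.scale /= rodrigues_atS -/P.
have E' (c z : R) : z `^ (c - k%:R - 1) = z `^ (c - k.+1%:R).
  by congr (_ `^ _); rewrite -natr1; ring.
rewrite !E' (powRS y a k y0) (powRS (1 + y) (b - p) k y1); field.
by rewrite gt_eqF.
Qed.

(** [b] enters the recursion only through [(b - k) * e], which vanishes at [e = 0]; what remains is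
    [(a - k - y) * P + y * P'], whatever [b] is. *)
Lemma derive1n_laguerre_weight a b k y : 0 < y ->
  derive1n k (fun z : R => z `^ a * expR (- z)) y =
    y `^ (a - k%:R) * expR (- y) * (rodrigues_at a b 0 k).[y].
Proof.
elim: k y => [|k IH] y y0.
  by rewrite derive1n0 !subr0 rodrigues_atE /= !hornerE.
rewrite derive1nS.
have d1 := is_derive1_powR (a - k%:R) y0.
have dx : is_derive y 1 (fun z : R => - z) (-1) by exact: is_deriveN (is_derive_id y 1).
have d2 := is_derive1_comp (is_derive_expR (- y)) dx.
have d3 := is_deriveM (is_deriveM d1 d2) (is_derive_poly (rodrigues_at a b 0 k) y).
rewrite (derive1_pos y0 IH d3) /= !(fctE, hornerE) /GRing.scale /= rodrigues_atS.
have -> : a - k%:R - 1 = a - k.+1%:R by rewrite -natr1; ring.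
by rewrite (powRS y a k y0); ring.
Qed.

(** The shift [r] is absorbed into [b = n - r - q], so the scale is exactly [p]. The powers left
    after [n] derivatives, with exponents [q] and [- (p + r + q)], cancel the prefactor. *)
Lemma M_poly_rodrigues n p q r x : 0 < p -> 0 < x ->
  (M_poly n (p + r) q).[x] =
    (-1) ^+ n * (rodrigues_at (n%:R + q) (n%:R - r - q) p^-1 n).[p * x].
Proof.
move=> p0 x0; rewrite M_polyE// /M_rodrigues.
have -> : n%:R - (p + r) - q = n%:R - r - q - p by ring.
rewrite derive1n_jacobi_weight//.
have -> : n%:R + q - n%:R = q by ring.
have -> : n%:R - r - q - p - n%:R = - (p + r + q) by ring.
have y0 : 0 < 1 + x by rewrite addr_gt0.
by rewrite powRN; field; rewrite !gt_eqF ?powR_gt0.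
Qed.

Lemma laguerre_rodrigues_at n a b x : 0 < x ->
  n`!%:R * (laguerre n a).[x] = (rodrigues_at (n%:R + a) b 0 n).[x].
Proof.
move=> x0; rewrite laguerreE// /laguerre_rodrigues (derive1n_laguerre_weight _ b)//.
have -> : n%:R + a - n%:R = a by ring.
rewrite powRN expRN; field.
by rewrite pnatr_eq0 -lt0n fact_gt0 !gt_eqF ?powR_gt0 ?expR_gt0.
Qed.

Lemma cvg_M_poly_laguerre n q r t : 0 < t ->
  (M_poly n (p + r) q).[t / p] @[p --> +oo] -->
    (-1) ^+ n * n`!%:R * (laguerre n q).[t].
Proof.
(* The free [b] is set to its value on the Jacobi side. *)
move=> t0; rewrite -mulrA (laguerre_rodrigues_at _ _ (n%:R - r - q))// rodrigues_atE.
(* [W] is a polynomial in [e] alone: since [p * (t / p) = t], the outer variable stays at [t] and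
   [p] enters only through [e = 1 / p]. *)
set W := (rodrigues_poly _ _ _).[_].
have W_cvg : (-1) ^+ n * W.[p^-1] @[p --> +oo] --> (-1) ^+ n * W.[0].
  apply: cvgMl_tmp; apply: (cvg_comp (fun p => p^-1) (horner W)); last first.
    exact: continuous_horner.
  by apply/gtr0_cvgV0; [exact: nbhs_pinfty_gt|exact: cvg_id].
apply: cvg_trans W_cvg; apply: near_eq_cvg; near=> p.
have p0 : 0 < p by near: p; exact: nbhs_pinfty_gt.
rewrite M_poly_rodrigues ?divr_gt0//.
by rewrite [p * _]mulrC divfK ?gt_eqF// rodrigues_atE.
Unshelve. all: by end_near. Qed.

End JacobiToLaguerre.

Theorem theorem3p10 (R : realType) (d : nat) (q : R) (m n : nat)
    (N : nat) (Y : 'I_N -> mpoly.mpoly d R) (l : 'I_N)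
    (hd : (2 <= d)%N) (hq : - d%:R < q) (hmn : (m <= n)%N)
    (hY : spherical_harmonics m Y) :
  forall (x : 'rV[R]_d) (t : R), 0 < t ->
    (S_M n m p q (Y l) x (t / p) @[p --> +oo] -->
      (-1) ^+ (n - m) * (n - m)`!%:R
        * (laguerre (n - m) (q + 2 * m%:R + d%:R - 1)).[t] * peval (Y l) x)
    /\ (-1) ^+ (n - m) * (n - m)`!%:R
        * (laguerre (n - m) (q + 2 * m%:R + d%:R - 1)).[t] * peval (Y l) x
       = (-1) ^+ (n - m) * (n - m)`!%:R * S_L n m q (Y l) x t.
Proof.
move=> x t t0; split; last first.
  have -> : q + 2 * m%:R + d%:R - 1 = 2 * m%:R + q + d%:R - 1 by ring.
  by rewrite -mulrA.
(* The constant [1 - 2 * m - d] is the shift [r]. *)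
have pE (p : R) : p - 2 * m%:R - d%:R + 1 = p + (1 - 2 * m%:R - d%:R) by ring.
under eq_fun do rewrite /S_M pE.
by apply: cvgMr_tmp; exact: cvg_M_poly_laguerre.
Qed.
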